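(* Let $n,k\ge1$ be integers, $\mathbb{X}=\{x_1,\dots,x_n\}$ a finite alphabet, and $\lambda$ a partition with at most $n$ parts. The coefficient of the Schur function $S_\lambda(\mathbb{X})$ in the expansion of $\Delta(\mathbb{X})^{2k}$ on the Schur basis is the hyperdeterminant $$\langle S_\lambda(\mathbb{X}),\Delta(\mathbb{X})^{2k}\rangle'_{n,1}=(-1)^{\frac{n(n-1)}{2}}\,\mathfrak{H}^{k+1}_{\mathrm{reverse}_n(\lambda)-((2k+1)(n-1))^n}(\mathbb{A}_{\mathbf 0}).$$
   Context: $\Delta(\mathbb{X})=\prod_{i<j}(x_i-x_j)$. The scalar product $\langle f,g\rangle'_{n,1}=\frac1{n!}\mathrm{C.T.}\left\{f(\mathbb{X})g(\mathbb{X}^\vee)\prod_{i\ne j}(1-x_ix_j^{-1})\right\}$, where $\mathbb{X}^\vee=\{x_1^{-1},\dots,x_n^{-1}\}$ and C.T. denotes the constant term in $x_1,\dots,x_n$; the Schur functions $S_\lambda(\mathbb{X})$ with $\lambda$ having at most $n$ parts are orthonormal for it. $\mathbb{A}_{\mathbf 0}$ is the (formal) alphabet with $\Lambda^0(\mathbb{A}_{\mathbf 0})=1$ and $\Lambda^m(\mathbb{A}_{\mathbf 0})=0$ for every integer $m\neq0$, $\Lambda^m$ denoting elementary symmetric functions. $\mathrm{reverse}_n(\lambda)=(\lambda_n,\dots,\lambda_1)$ ($\lambda$ completed by zeros to length $n$), and $(c)^n$ is the constant vector $(c,\dots,c)\in\mathbb{Z}^n$. Hyperdeterminant: for an integer $K\ge1$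 and $M=(M_{i_1\cdots i_{2K}})_{0\le i_1,\dots,i_{2K}\le n-1}$, $\mathrm{Det}(M)=\frac1{n!}\sum_{\sigma_1,\dots,\sigma_{2K}}\mathrm{sign}(\sigma_1)\cdots\mathrm{sign}(\sigma_{2K})\prod_{i=0}^{n-1}M_{\sigma_1(i)\cdots\sigma_{2K}(i)}$, the sum being over $2K$-tuples of permutations of $\{0,\dots,n-1\}$. Shifted Hankel hyperdeterminant, for $v=(v_0,\dots,v_{n-1})\in\mathbb{Z}^n$: $\mathfrak{H}^K_v(\mathbb{A})=\mathrm{Det}\left(\Lambda^{i_1+\cdots+i_{2K}+v_{i_1}}(\mathbb{A})\right)_{0\le i_1,\dots,i_{2K}\le n-1}$. *)

(* Defs.v *)
From HB Require Import structures.
From mathcomp Require Import all_boot all_order all_fingroup all_algebra.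
From mathcomp.multinomials Require Import mpoly.
From Stdlib Require Import ClassicalEpsilon.

Set Implicit Arguments.
Unset Strict Implicit.
Unset Printing Implicit Defensive.

Import GRing.Theory Num.Theory.
Local Open Scope ring_scope.

(* Partitions are non-increasing sequences of positive integers; the trailing *)
(* zeros are supplied by nth 0. *)
Definition is_part (n : nat) (mu : seq nat) : bool :=
  [&& sorted geq mu, 0%N \notin mu & (size mu <= n)%N].

Definition reverse_part (n : nat) (mu : seq nat) : 'I_n -> int :=
  fun i => (nth 0%N mu (rev_ord i))%:Z.

Section SymmetricPolynomials.
Variables (n : nat) (R : nzRingType).

(* S^m(X), for m in Z; it vanishes for m < 0. *)
Definition complete (m : int) : {mpoly R[n]} :=
  match m with
  | Posz d => \sum_(e : 'X_{1..n < d.+1} | mdeg e == d) 'X_[e]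
  | Negz _ => 0
  end.

End SymmetricPolynomials.

(* Jacobi-Trudi definition of the Schur function S_mu(X). *)
Definition schur (n : nat) (R : comNzRingType) (mu : seq nat) : {mpoly R[n]} :=
  \det (\matrix_(i < size mu, j < size mu)
          complete n R ((nth 0%N mu i)%:Z + j%:Z - i%:Z)).

Definition vandermonde (n : nat) (R : comNzRingType) : {mpoly R[n]} :=
  \prod_(i < n) \prod_(j < n | (i < j)%N) ('X_i - 'X_j).

(* a is the coefficient of S_lam in an expansion of f as a finite linear      *)
(* combination of the S_mu, mu running over partitions with at most n parts;  *)
(* lam occurs with coefficient 0 when it is not in the list P. *)
Definition is_schur_coef (n : nat) (R : comNzRingType)
    (f : {mpoly R[n]}) (lam : seq nat) (a : R) : Prop :=
  exists (P : seq (seq nat)) (c : seq nat -> R),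
    [/\ uniq P, all (is_part n) P,
        f = \sum_(mu <- P) c mu *: schur n R mu &
        a = if lam \in P then c lam else 0].

Section ScalarProduct.
Variables (n : nat) (R : fieldType).

(* Laurent polynomials in x_1, ..., x_n are the elements of this field of the *)
(* form p / (x_1 ... x_n)^N, with p a polynomial. *)
Local Notation ratfun := {fraction {mpoly R[n]}}.

Definition xvar (i : 'I_n) : ratfun := tofrac 'X_i.

Definition mon_all : ratfun := \prod_(i < n) xvar i.

(* c is the constant term of the Laurent polynomial F = p / (x_1 ... x_n)^N,  *)
(* i.e. the coefficient of (x_1 ... x_n)^N in p. *)
Definition is_const_term (F : ratfun) (c : R) : Prop :=
  exists (N : nat) (p : {mpoly R[n]}),
    F = tofrac p / mon_all ^+ N /\ c = p@_[multinom N | _ < n].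

(* C.T.; unspecified on the rational functions that are not Laurent           *)
(* polynomials (is_const_term determines c, see is_const_term_uniq). *)
Definition const_term (F : ratfun) : R :=
  epsilon (inhabits 0) (is_const_term F).

Definition at_X (f : {mpoly R[n]}) : ratfun := tofrac f.

(* g(X^\vee) = g(x_1^-1, ..., x_n^-1) *)
Definition at_Xdual (g : {mpoly R[n]}) : ratfun :=
  mmap (fun c : R => tofrac c%:MP) (fun i => (xvar i)^-1) g.

(* <f, g>'_{n,1} *)
Definition scalar_prod (f g : {mpoly R[n]}) : R :=
  (n`!%:R)^-1 *
  const_term (at_X f * at_Xdual g *
    \prod_(i < n) \prod_(j < n | i != j) (1 - xvar i * (xvar j)^-1)).

Lemma mon_allE N : mon_all ^+ N = tofrac 'X_[[multinom N | _ < n]].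
Proof.
rewrite /mon_all /xvar -rmorph_prod -rmorphXn /= mpolyXE_id -prodrXl.
by congr tofrac; apply: eq_bigr => i _; rewrite mnmE.
Qed.

Lemma mon_all_neq0 N : mon_all ^+ N != 0.
Proof.
rewrite expf_neq0 //; apply/prodf_neq0 => i _.
rewrite /xvar tofrac_eq0; apply/eqP => /mpolyP/(_ U_(i)%MM)/eqP.
by rewrite mcoeffX mcoeff0 eqxx oner_eq0.
Qed.

Lemma is_const_term_uniq F c d :
  is_const_term F c -> is_const_term F d -> c = d.
Proof.
move=> [N [p [-> ->]]] [M [q [/eqP e ->]]]; move: e.
rewrite eqr_div ?mon_all_neq0 // !mon_allE -!tofracM tofrac_eq => /eqP e.
rewrite -(mcoeffMX p [multinom M | _ < n]) e addmC.
by rewrite mcoeffMX.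
Qed.

Lemma const_termE N (p : {mpoly R[n]}) :
  const_term (tofrac p / mon_all ^+ N) = p@_[multinom N | _ < n].
Proof.
have h : is_const_term (tofrac p / mon_all ^+ N) p@_[multinom N | _ < n].
  by exists N, p.
exact: is_const_term_uniq (epsilon_spec _ _ (ex_intro _ _ h)) h.
Qed.

End ScalarProduct.

(* A (formal) alphabet is a specialization of the symmetric functions, i.e.   *)
(* the datum of its elementary symmetric functions Lambda^m, m in Z. *)
Record alphabet (R : nzRingType) := Alphabet {
  Lam :> int -> R;
  Lam0 : Lam 0 = 1;
  Lam_neg : forall m : int, m < 0 -> Lam m = 0
}.

Section A0.
Variable R : nzRingType.

Lemma A0_neg (m : int) : m < 0 -> (m == 0)%:R = 0 :> R.
Proof. by move=> /ltr0_neq0/negbTE->. Qed.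

Definition A0 : alphabet R :=
  @Alphabet R (fun m => (m == 0)%:R) erefl A0_neg.

End A0.

Section Hyperdeterminants.
Variables (n : nat) (R : fieldType).

(* Det(M) for a tensor M with 2K indices, each in {0, ..., n-1}. *)
Definition hyperdet (K : nat) (M : ('I_(2 * K) -> 'I_n) -> R) : R :=
  (n`!%:R)^-1 *
  \sum_(s : {ffun 'I_(2 * K) -> {perm 'I_n}})
    (\prod_j (-1) ^+ (s j : bool)) * \prod_(i < n) M (fun j => s j i).

(* H^K_v(A). Under the sum over the positions j of the indices, v is          *)
(* evaluated at the index in first position only. *)
Definition hankel_hyperdet (K : nat) (v : 'I_n -> int) (A : alphabet R) : R :=
  @hyperdet K (fun idx =>
    A (\sum_j (idx j)%:Z + \sum_(j < 2 * K | j == 0%N :> nat) v (idx j))).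

End Hyperdeterminants.

(* Main.v *)
Require Import Defs.
From HB Require Import structures.
From mathcomp Require Import all_boot all_order all_fingroup all_algebra.
From mathcomp Require Import ring zify.
From mathcomp.multinomials Require Import mpoly.

Set Implicit Arguments.
Unset Strict Implicit.
Unset Printing Implicit Defensive.

Import GRing.Theory Num.Theory.
Local Open Scope ring_scope.

(** Write a_b = det (x_l ^ b_i) for the alternant with exponents b, and put
    delta = (n-1, ..., 1, 0).  Everything rests on the bialternant formula
    S_mu Delta = a_(mu + delta) ([schur_alternant]), which has to be derived
    from the Jacobi-Trudi determinant.

    The weight prod_(i <> j) (1 - x_i / x_j) is Delta(X) Delta(X^vee), so
    <S_lam, f>' is 1/n! times the constant term of
    a_(lam + delta)(X) (f Delta)(X^vee), that is, the sum over all exponents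
    of the products of the coefficients of these two polynomials
    ([const_term_pairing]).  If f is symmetric, f Delta is alternating, the n!
    terms of a_(lam + delta) contribute equally, and <S_lam, f>' is the
    coefficient of x^(lam + delta) in f Delta ([scalar_prod_schur]).  On the
    other hand an alternating polynomial is the combination of the a_e, for e
    strictly decreasing, weighted by its own coefficients at x^e
    ([alternating_expand]); dividing by Delta, the same number is the
    coefficient of S_lam in f.  With f = Delta^(2k) this is the first claim.

    For the hyperdeterminant, Delta(X^vee) is
    (-1)^(n(n-1)/2) Delta(X) / (x_1 ... x_n)^(n-1), so the scalar product
    is (-1)^(n(n-1)/2) / n! times the coefficient of (x_1 ... x_n)^N in
    a_(lam + delta) Delta^(2k+1), where N = (2k+1)(n-1).  Listing the exponents
    in increasing order makes each of these 2k+2 factors an alternant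
    det (x_l ^ (i + shift_i)), and the 2k+2 reversal signs cancel.  Expanding
    the 2k+2 determinants gives a signed sum over 2k+2 permutations; taking the
    coefficient of (x_1 ... x_n)^N requires, for each variable, that the sum of
    the shifted indices be N.  Since Lambda^m(A_0) is 1 at m = 0 and 0
    elsewhere, this condition is the product of entries in the
    hyperdeterminant ([hankel_hyperdet_A0]). *)

(** * Alternants *)

Section Alternants.
Variables (n : nat) (R : comNzRingType).

Definition alternant (a : 'I_n -> nat) : {mpoly R[n]} :=
  \det (\matrix_(l < n, i < n) 'X_l ^+ a i).

(** Antisymmetry stated on coefficients, the form in which sums over exponents
    use it; [alternating_sign] relates it to the action on polynomials. *)
Definition alternating (p : {mpoly R[n]}) : Prop :=
  forall (s : 'S_n) (m : 'X_{1..n}),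
    p@_[multinom m (s i) | i < n] = (-1) ^+ s * p@_m.

(** The exponents mu + delta. *)
Definition shifted (mu : seq nat) (i : 'I_n) : nat :=
  (nth 0%N mu i + (n - i.+1))%N.

Lemma alternantE (a : 'I_n -> nat) :
  alternant a =
  \sum_(s : 'S_n) (-1) ^+ s *: 'X_[[multinom a (s i) | i < n]].
Proof.
apply: eq_bigr => s _; rewrite mpolyXE_id -mul_mpolyC rmorphXn rmorphN1.
congr (_ * _).
by apply: eq_bigr => i _; rewrite !mxE mnmE.
Qed.

Lemma mcoeff_alternant (a : 'I_n -> nat) m :
  (alternant a)@_m =
  \sum_(s : 'S_n) (-1) ^+ s * ([multinom a (s i) | i < n] == m)%:R.
Proof.
rewrite alternantE raddf_sum; apply: eq_bigr => s _.
by rewrite /= mcoeffZ mcoeffX.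
Qed.

Lemma alternating_sign (p : {mpoly R[n]}) :
  (forall s : 'S_n, msym s p = (-1) ^+ s * p) -> alternating p.
Proof.
move=> h s m; rewrite -mcoeff_sym h.
by case: (odd_perm s); rewrite /= ?expr1 ?expr0 ?mulN1r ?mcoeffN ?mulN1r ?mul1r.
Qed.

Lemma msymU (l : 'I_n) (s : 'S_n) :
  msym s ('X_l : {mpoly R[n]}) = 'X_(s l).
Proof. by rewrite /msym mmapX mmap1U. Qed.

Lemma msym_alternant (a : 'I_n -> nat) (s : 'S_n) :
  msym s (alternant a) = (-1) ^+ s * alternant a.
Proof.
rewrite /alternant -det_map_mx -det_perm -det_mulmx -row_permE.
by congr (\det _); apply/matrixP => l i; rewrite !mxE rmorphXn /= msymU.
Qed.

Lemma alternant_perm (a : 'I_n -> nat) (s : 'S_n) :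
  alternant (a \o s) = (-1) ^+ s * alternant a.
Proof.
rewrite /alternant -odd_permV mulrC -det_perm -det_mulmx -col_permE.
by congr (\det _); apply/matrixP => l i; rewrite !mxE.
Qed.

Definition rev_perm : 'S_n := perm (@rev_ord_inj n).

Lemma vandermonde_alternant :
  vandermonde n R = alternant (fun i => n - i.+1)%N.
Proof.
have -> : alternant (fun i => n - i.+1)%N =
   \det (Vandermonde n (\row_i ('X_(rev_ord i) : {mpoly R[n]}))).
  transitivity (alternant ((@nat_of_ord n) \o rev_perm)).
    by congr (\det _); apply/matrixP => l i; rewrite !mxE /= permE.
  rewrite alternant_perm -msym_alternant /alternant -det_map_mx -[LHS]det_tr.
  congr (\det _); apply/matrixP => i l; rewrite !mxE rmorphXn /= msymU permE.
  by [].
(* The library's Vandermonde product has the factors x_j - x_i for i < j;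
   reversing the variables turns them into x_i - x_j. *)
rewrite det_Vandermonde /vandermonde pair_big_dep [RHS]pair_big_dep /=.
rewrite (reindex (fun p : 'I_n * 'I_n => (rev_ord p.2, rev_ord p.1))) /=.
  apply: eq_big => [[i j]|[i j] _] /=; last by rewrite !mxE.
  by have := ltn_ord i; have := ltn_ord j; rewrite ltn_sub2lE // ltnS.
by exists (fun p : 'I_n * 'I_n => (rev_ord p.2, rev_ord p.1)) => -[i j] _ /=;
   rewrite !rev_ordK.
Qed.

End Alternants.

(** * The bialternant formula *)

Section JacobiTrudi.
Variables (n : nat) (R : comNzRingType).
Implicit Types (S : {set 'I_n}) (m : int).

(** The complete symmetric function in the variables indexed by S, as an element
    of the ring in all n variables, so that variables can be removed one by
    one. *)
Definition complete_on S m : {mpoly R[n]} :=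
  match m with
  | Posz d => \sum_(e : 'X_{1..n < d.+1} |
      (mdeg e == d) && [forall i, (i \in S) || (e i == 0%N)]) 'X_[e]
  | Negz _ => 0
  end.

Lemma mcoeff_complete_on S m e :
  (complete_on S m)@_e =
  (((mdeg e)%:Z == m) && [forall i, (i \in S) || (e i == 0%N)])%:R.
Proof.
case: m => [d|d] /=; last by rewrite mcoeff0.
rewrite raddf_sum /= eqz_nat; have [de|nde] := eqVneq (mdeg e) d; last first.
  rewrite big1 // => f /andP[/eqP df _]; rewrite mcoeffX.
  by case: eqP => // fe; rewrite -fe df eqxx in nde.
have ed : (mdeg e < d.+1)%N by rewrite de.
have [he|he] /= := boolP [forall i, (i \in S) || (e i == 0%N)]; last first.
  rewrite big1 // => f /andP[_ hf]; rewrite mcoeffX; case: eqP => // fe.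
  by rewrite -fe hf in he.
rewrite (bigD1 (BMultinom ed)) /= ?de ?eqxx // mcoeffX eqxx big1 ?addr0 //.
move=> f /andP[_ nf]; rewrite mcoeffX; case: eqP => // fe.
by case/eqP: nf; exact: val_inj.
Qed.

Lemma complete_onT m : complete_on [set: 'I_n] m = complete n R m.
Proof.
case: m => [d|//]; apply: eq_bigl => e.
by rewrite (_ : [forall i, _]) ?andbT //; apply/forallP => i; rewrite inE.
Qed.

Lemma mcoeffXM l (p : {mpoly R[n]}) e :
  ('X_l * p)@_e = if (0 < e l)%N then p@_(e - U_(l)) else 0.
Proof.
case: ifP => el.
  rewrite -[in LHS](@submK _ U_(l)%MM e); last first.
    by apply/mnm_lepP => i; rewrite mnm1E; case: eqP => [<-|].
  by rewrite mulrC addmC mcoeffMX.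
rewrite mcoeffM big1 // => k /eqP ek; rewrite mcoeffX.
case: eqP => [kl|_]; last by rewrite mul0r.
by move: el; rewrite (congr1 (fun f : 'X_{1..n} => f l) ek) mnmDE -kl mnm1E
  eqxx.
Qed.

(** A monomial of degree m in the variables of S either avoids x_l or is x_l
    times a monomial of degree m - 1. *)
Lemma complete_on_setD1 S l m : l \in S ->
  complete_on (S :\ l) m = complete_on S m - 'X_l * complete_on S (m - 1).
Proof.
move=> lS; apply/mpolyP => e; rewrite mcoeffB mcoeffXM !mcoeff_complete_on.
have [el|] := posnP (e l).
  rewrite subr0; congr ((_ && _)%:R); apply: eq_forallb => i; rewrite !inE.
  by case: eqP => // ->; rewrite el lS.
move=> el; rewrite [in LHS](_ : [forall i, _] = false) ?andbF; last first.
  by apply/negbTE/forallPn; exists l; rewrite !inE eqxx /= -lt0n.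
have le : (U_(l) <= e)%MM.
  by apply/mnm_lepP => i; rewrite mnm1E; case: eqP => [<-|].
have de : (mdeg e)%:Z = (mdeg (e - U_(l))%MM)%:Z + 1.
  by rewrite -{1}(submK le) mdegD mdeg1 PoszD.
rewrite de -(inj_eq (addIr (-1))) addrK.
rewrite (_ : [forall i, (i \in S) || (e i == 0%N)] =
  [forall i, (i \in S) || ((e - U_(l))%MM i == 0%N)]) ?subrr //.
apply: eq_forallb => i; rewrite mnmBE mnm1E.
by case: (l =P i) => [<-|_]; rewrite ?lS ?subn0.
Qed.

Lemma complete_on_set1 l (d : nat) : complete_on [set l] d%:Z = 'X_l ^+ d.
Proof.
apply/mpolyP => e; rewrite mcoeff_complete_on mcoeffXn eqz_nat; congr (_ : bool)%:R.
apply/andP/eqP => [[/eqP de /forallP el]|<-].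
  apply/mnmP => i; rewrite mulmnE mnm1E.
  have z j : j != l -> e j = 0%N.
    by move=> jl; have := el j; rewrite inE (negbTE jl) => /eqP.
  case: eqP => [<-|/eqP il]; last by rewrite mul0n z // eq_sym.
  by rewrite -de mdegE (bigD1 l) //= big1 ?addn0 ?mul1n.
split; first by rewrite mdegMn mdeg1 mul1n.
apply/forallP => i; rewrite inE mulmnE mnm1E eq_sym.
by case: eqP => //; rewrite mul0n.
Qed.

(** Iterating [complete_on_setD1] expresses the complete functions in fewer
    variables through those in all variables.  The coefficients c_j are, up to
    sign, elementary symmetric functions of the removed variables; what matters
    is that they do not depend on m. *)
Lemma remove_variables (s : seq 'I_n) : uniq s ->
  exists c : nat -> {mpoly R[n]}, forall m,
    \sum_(j < (size s).+1) c j * complete n R (m - j%:Z) =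
    complete_on [set i | i \notin s] m.
Proof.
elim: s => [|x s IHs] /=.
  exists (fun=> 1) => m; rewrite big_ord1 mul1r subr0 -complete_onT.
  by congr complete_on; apply/setP => i; rewrite !inE.
move=> /andP[xs /IHs[c hc]].
(* Multiplication of the generating polynomial of c by 1 - x t; the cut-off at
   size s is there because the induction says nothing of c beyond it. *)
exists (fun j => (if (j <= size s)%N then c j else 0) -
                 (if j is i.+1 then 'X_x * c i else 0)) => m.
have -> : [set i | i \notin x :: s] = [set i | i \notin s] :\ x.
  by apply/setP => i; rewrite !inE negb_or.
rewrite complete_on_setD1 ?inE // -!hc mulr_sumr.
under eq_bigr do rewrite mulrBl.
rewrite big_split /= sumrN; congr (_ - _).
  rewrite big_ord_recr /= ltnn mul0r addr0; apply: eq_bigr => j _.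
  by rewrite -ltnS ltn_ord.
rewrite big_ord_recl /= mul0r add0r; apply: eq_bigr => j _.
by rewrite mulrA intS opprD addrA.
Qed.

(** Remove all the variables but x_l. *)
Lemma power_complete (l : 'I_n) :
  exists c : nat -> {mpoly R[n]}, forall d : nat,
    'X_l ^+ d = \sum_(j < n) c j * complete n R (d%:Z - j%:Z).
Proof.
have [|c hc] := @remove_variables (rem l (enum 'I_n)).
  by rewrite rem_uniq ?enum_uniq.
exists c => d; rewrite -complete_on_set1.
have -> : [set l] = [set i | i \notin rem l (enum 'I_n)].
  by apply/setP => i; rewrite !inE mem_rem_uniq ?enum_uniq // !inE mem_enum andbT negbK.
rewrite -hc size_rem ?mem_enum // size_enum_ord prednK //.
exact: leq_ltn_trans (ltn_ord l).
Qed.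

(** Jacobi-Trudi determinant of arbitrary size N, used with N = n to match the
    size of the alternants. *)
Definition jacobi_trudi (N : nat) (mu : seq nat) : {mpoly R[n]} :=
  \det (\matrix_(i < N, j < N)
    complete n R ((nth 0%N mu i)%:Z + j%:Z - i%:Z)).

(** Each row past the length of mu is zero left of the diagonal and has S^0 = 1
    on it, so expanding along the last row lowers N by one. *)
Lemma jacobi_trudi_pad N mu : (size mu <= N)%N ->
  jacobi_trudi N mu = schur n R mu.
Proof.
move=> /subnKC <-; elim: (N - size mu)%N => [|r IHr]; first by rewrite addn0.
rewrite -{}IHr addnS; set M := (size mu + r)%N.
rewrite /jacobi_trudi (expand_det_row _ ord_max) big_ord_recr /= big1 ?add0r.
  rewrite mxE nth_default ?leq_addr // add0r subrr.
  rewrite /cofactor -signr_odd oddD addbb mul1r.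
  rewrite [complete _ _ _](_ : _ = 1) ?mul1r.
    by congr (\det _); apply/matrixP => i j; rewrite !mxE !lift_max.
  rewrite -complete_onT; apply/mpolyP => e.
  rewrite mcoeff_complete_on mcoeff1 eqz_nat mdeg_eq0; congr (_ : bool)%:R.
  by rewrite (_ : [forall i, _]) ?andbT //; apply/forallP => i; rewrite inE.
move=> j _; rewrite mxE nth_default ?leq_addr // add0r /=.
rewrite -opprB subzn; last exact: ltnW (ltn_ord j).
case E : (M - j)%N => [|k]; last by rewrite /= mul0r.
by move/eqP: E; rewrite subn_eq0 leqNgt ltn_ord.
Qed.

(** By [power_complete] the matrix of a_(mu + delta) is the product of a matrix
    independent of mu with the Jacobi-Trudi matrix of mu.  The case mu = 0, where
    the Jacobi-Trudi determinant is 1, identifies the determinant of the first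
    factor as Delta. *)
Lemma schur_alternant mu : (size mu <= n)%N ->
  schur n R mu * vandermonde n R = alternant R (shifted mu).
Proof.
have [c hc] := fin_all_exists power_complete.
have fact nu : alternant R (@shifted n nu) =
    \det (\matrix_(l, j < n) c l (n - j.+1)%N) * jacobi_trudi n nu.
  rewrite /jacobi_trudi -[\det (\matrix_(_, _) complete _ _ _)]det_tr -det_mulmx.
  congr (\det _); apply/matrixP => l i; rewrite !mxE hc.
  rewrite (reindex_inj rev_ord_inj); apply: eq_bigr => j _; rewrite !mxE /=.
  congr (_ * complete _ _ _); rewrite /shifted PoszD -!subzn ?ltn_ord //.
  by rewrite !intS !opprD !opprK !addrA; ring.
move=> mun; rewrite fact jacobi_trudi_pad // mulrC; congr (_ * _).
rewrite vandermonde_alternant.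
have -> : alternant R (fun i : 'I_n => n - i.+1)%N = alternant R (@shifted n [::]).
  by congr (\det _); apply/matrixP => l i; rewrite !mxE /shifted nth_nil.
rewrite fact jacobi_trudi_pad // /schur det_mx00 mulr1 //.
Qed.

End JacobiTrudi.

(** * Partitions and strictly decreasing exponents *)

Section StrictExponents.
Variable n : nat.
Implicit Types (e m : 'X_{1..n}) (mu nu : seq nat).

Definition strict_exp e : bool :=
  [forall i : 'I_n, forall j : 'I_n, (i < j)%N ==> (e j < e i)%N].

Lemma strict_expP e :
  reflect (forall i j : 'I_n, (i < j)%N -> (e j < e i)%N) (strict_exp e).
Proof.
apply: (iffP forallP) => [h i j|h i]; last by apply/forallP => j; apply/implyP/h.
by apply/implyP; have /forallP := h i; apply.
Qed.

Lemma strict_exp_sorted e : strict_exp e -> sorted geq e.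
Proof.
move=> /strict_expP he; apply/(sortedP 0%N) => i; rewrite size_tuple => i1.
have i0 := ltnW i1; have := he (Ordinal i0) (Ordinal i1) (ltnSn i).
by rewrite !(mnm_nth 0) => /ltnW.
Qed.

(** Both exponents sort the same values decreasingly, so they are equal, and
    only the identity fixes an exponent with distinct entries. *)
Lemma strict_exp_perm e m (s : 'S_n) : strict_exp e -> strict_exp m ->
  [multinom e (s i) | i < n] = m -> s = 1%g.
Proof.
move=> he hm em.
have perm_em : perm_eq m e.
  by apply/tuple_permP; exists s; rewrite -em.
have /val_inj/val_inj eq_em : (m : seq nat) = e.
  apply: (@sorted_eq _ geq) => //; try exact: strict_exp_sorted.
    by move=> x y z /= xy /leq_trans; apply.
  by move=> x y; rewrite /geq /= -eqn_leq eq_sym => /eqP.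
apply/permP => i; rewrite perm1; apply/val_inj/eqP.
move: em; rewrite eq_em => /mnmP/(_ i); rewrite mnmE => esi.
have /strict_expP h := he.
by case: ltngtP => // /h; rewrite esi ltnn.
Qed.

Lemma sort_exp m : exists s : 'S_n,
  forall i j : 'I_n, (i < j)%N -> (m (s j) <= m (s i))%N.
Proof.
have /tuple_permP[s hs] : perm_eq (sort geq m) m by rewrite perm_sort.
exists s => i j ij; have sm : sorted geq (sort geq m).
  by apply: sort_sorted => x y; exact: leq_total.
have nthE (l : 'I_n) : m (s l) = nth 0%N (sort geq m) l.
  by rewrite hs -tnth_nth tnth_mktuple -mnm_tnth.
rewrite !nthE; apply: (sorted_ltn_nth _ 0%N sm) => //.
  by move=> x y z /= xy /leq_trans; apply.
all: by rewrite inE size_sort size_tuple ltn_ord.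
Qed.

Definition part_exp mu : 'X_{1..n} := [multinom shifted mu i | i < n].

(** Subtracting delta from a strictly decreasing exponent leaves a partition,
    possibly with trailing zeros, which [is_part] forbids. *)
Definition exp_part e : seq nat :=
  [seq d <- [seq (e i - (n - i.+1))%N | i <- enum 'I_n] | (0 < d)%N].

Lemma nth_part_ge mu (i j : nat) : sorted geq mu -> (i <= j)%N ->
  (nth 0%N mu j <= nth 0%N mu i)%N.
Proof.
move=> smu ij; have [js|js] := ltnP j (size mu); last by rewrite nth_default.
apply: (sorted_leq_nth _ _ 0%N smu) => //.
  by move=> x y z /= xy /leq_trans; apply.
  by move=> x; exact: leqnn.
by rewrite inE (leq_ltn_trans ij).
Qed.

Lemma strict_part_exp mu : is_part n mu -> strict_exp (part_exp mu).
Proof.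
move=> /and3P[smu _ _]; apply/strict_expP => i j ij.
rewrite !mnmE /shifted -addnS leq_add //; first exact/nth_part_ge/ltnW.
by rewrite -subSn ?ltn_ord // subSS leq_sub2l.
Qed.

Lemma part_exp_inj mu nu : is_part n mu -> is_part n nu ->
  part_exp mu = part_exp nu -> mu = nu.
Proof.
have size_le a b : is_part n a -> is_part n b -> part_exp a = part_exp b ->
    (size b <= size a)%N.
  move=> /and3P[_ _ _] /and3P[_ b0 bn] /mnmP ab; rewrite leqNgt; apply/negP => lt.
  case/negP: b0; have := ab (Ordinal (leq_trans lt bn)).
  rewrite !mnmE /shifted => /addIn /=; rewrite nth_default // => ->.
  exact: mem_nth.
move=> hmu hnu e; apply: (@eq_from_nth _ 0%N).
  by apply/eqP; rewrite eqn_leq !size_le.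
move=> i imu; have /and3P[_ _ mun] := hmu.
move/mnmP/(_ (Ordinal (leq_trans imu mun))): e.
by rewrite !mnmE /shifted => /addIn.
Qed.

(** Below e_i there are n - 1 - i further distinct natural numbers. *)
Lemma strict_exp_ge e (i : 'I_n) : strict_exp e -> (n - i.+1 <= e i)%N.
Proof.
move=> /strict_expP he; case: i => i lt_in; rewrite -[X in (X <= _)%N]/(n - i.+1)%N.
have [k] := ubnP (n - i.+1); elim: k i lt_in => // k IHk i lt_in.
rewrite ltnS => hk; have [i1|] := ltnP i.+1 n; last by rewrite -subn_eq0 => /eqP ->.
have lt_k : (n - i.+2 < k)%N by apply: leq_trans hk; rewrite ltn_sub2l.
have := IHk _ i1 lt_k; move/leq_ltn_trans => /(_ _ (he (Ordinal lt_in) (Ordinal i1) (ltnSn i))).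
by apply: leq_trans; rewrite -subSn // subSS.
Qed.

Lemma exp_partP e : strict_exp e ->
  is_part n (exp_part e) /\ part_exp (exp_part e) = e.
Proof.
move=> he; set d := [seq (e i - (n - i.+1))%N | i <- enum 'I_n].
have size_d : size d = n by rewrite size_map size_enum_ord.
have nth_d (i : 'I_n) : nth 0%N d i = (e i - (n - i.+1))%N.
  by rewrite (nth_map i) ?size_enum_ord // nth_ord_enum.
have sd : sorted geq d.
  apply/(sortedP 0%N) => i; rewrite size_d => i1; have i0 := ltnW i1.
  rewrite (nth_d (Ordinal i0)) (nth_d (Ordinal i1)) /=.
  have /strict_expP/(_ (Ordinal i0) (Ordinal i1) (ltnSn i)) := he.
  have /= := strict_exp_ge (Ordinal i0) he; have /= := strict_exp_ge (Ordinal i1) he.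
  rewrite /geq /=.
  lia.
have filter_nil (t : seq nat) : sorted geq (0%N :: t) -> [seq x <- t | (0 < x)%N] = [::].
  elim: t => //= x t IHt /andP[]; rewrite /geq /= leqn0 => /eqP -> /=.
  exact: IHt.
have nth_filter (t : seq nat) i : sorted geq t ->
    nth 0%N [seq x <- t | (0 < x)%N] i = nth 0%N t i.
  elim: t i => //= -[|x] t IHt i st; last first.
    by case: i => //= i; rewrite IHt //; exact: path_sorted st.
  rewrite filter_nil // nth_nil; apply/eqP; rewrite eq_sym -leqn0.
  exact: (@nth_part_ge (0%N :: t) 0 i st (leq0n _)).
split.
  apply/and3P; split; last by rewrite -[X in (_ <= X)%N]size_d size_filter count_size.
    apply: sorted_filter sd => x y z /= xy /leq_trans; exact.
  by rewrite mem_filter.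
apply/mnmP => i; rewrite mnmE /shifted nth_filter // nth_d subnK //.
exact: strict_exp_ge.
Qed.

End StrictExponents.

(** * Expansion of alternating polynomials *)

Section AlternatingBasis.
Variables (n : nat) (R : numFieldType).
Implicit Types (p : {mpoly R[n]}) (e m : 'X_{1..n}).

(** Among the exponents of the terms of a_e, only e itself is strictly
    decreasing. *)
Lemma mcoeff_alternant_strict e m : strict_exp e -> strict_exp m ->
  (alternant R e)@_m = (e == m)%:R.
Proof.
move=> he hm; rewrite mcoeff_alternant (bigD1 1%g) //= odd_perm1 mul1r.
rewrite big1 ?addr0 => [|s /eqP s1]; last first.
  by case: eqP => [/(strict_exp_perm he hm)|]; rewrite ?mulr0.
by congr ((_ == _)%:R); apply/mnmP => i; rewrite mnmE perm1.
Qed.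

Lemma alternating_alternant (a : 'I_n -> nat) : alternating (alternant R a).
Proof. by apply: alternating_sign => s; exact: msym_alternant. Qed.

(** Any exponent can be sorted decreasingly at the cost of a sign; if two of its
    entries agree, exchanging them shows that the coefficient is its own
    opposite. *)
Lemma alternating_eq0 p : alternating p ->
  (forall m, strict_exp m -> p@_m = 0) -> p = 0.
Proof.
move=> alt p0; apply/mpolyP => m; rewrite mcoeff0.
have [s hs] := sort_exp m; pose e : 'X_{1..n} := [multinom m (s i) | i < n].
suff e0 : p@_e = 0.
  by apply/eqP; move/eqP: e0; rewrite alt mulf_eq0 signr_eq0.
have [/p0 //|] := boolP (strict_exp e).
rewrite /strict_exp negb_forall => /existsP[i].
rewrite negb_forall => /existsP[j]; rewrite negb_imply -leqNgt => /andP[ij eij].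
have {}eij : e i = e j.
  by apply/eqP; rewrite eqn_leq eij !mnmE hs.
have := alt (tperm i j) e; rewrite odd_tperm (_ : i != j); last first.
  by apply/eqP => ji; rewrite ji ltnn in ij.
rewrite (_ : [multinom _ | _ < n] = e); last first.
  by apply/mnmP => l; rewrite mnmE; case: tpermP => // ->; rewrite eij.
rewrite expr1 mulN1r => /eqP; rewrite -addr_eq0 -mulr2n mulrn_eq0 /=.
by move/eqP.
Qed.

Lemma alternating_expand p : alternating p ->
  p = \sum_(e <- msupp p | strict_exp e) p@_e *: alternant R e.
Proof.
move=> alt; apply/eqP; rewrite -subr_eq0; apply/eqP/alternating_eq0 => [s m|m hm].
  rewrite !mcoeffB alt mulrBr; congr (_ - _); rewrite !(raddf_sum (mcoeff _)) mulr_sumr.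
  by apply: eq_bigr => e _; rewrite /= !mcoeffZ alternating_alternant mulrCA.
rewrite mcoeffB raddf_sum /=.
have coefE e : strict_exp e -> (p@_e *: alternant R e)@_m = (e == m)%:R * p@_m.
  move=> he; rewrite mcoeffZ mcoeff_alternant_strict // mulrC.
  by case: eqP => [->|]; rewrite ?mul0r.
have [mp|mp] := boolP (m \in msupp p); last first.
  rewrite (memN_msupp_eq0 mp) big1_seq ?subrr // => e /andP[he ep].
  by rewrite coefE // (memN_msupp_eq0 mp) mulr0.
rewrite -big_filter (bigD1_seq m) ?filter_uniq ?msupp_uniq ?mem_filter ?hm //=.
rewrite coefE // eqxx mul1r big1_seq ?addr0 ?subrr // => e /andP[/negbTE em].
by rewrite mem_filter => /andP[he _]; rewrite coefE // em mul0r.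
Qed.

Lemma vandermonde_neq0 : vandermonde n R != 0.
Proof.
apply/prodf_neq0 => i _; apply/prodf_neq0 => j ij.
rewrite subr_eq0; apply/eqP => /mpolyP/(_ U_(i)%MM)/eqP.
rewrite !mcoeffXU eqxx (_ : j == i = false) ?oner_eq0 //.
by apply/eqP => ji; rewrite ji ltnn in ij.
Qed.

Lemma schur_part_exp mu : is_part n mu ->
  schur n R mu * vandermonde n R = alternant R (part_exp n mu).
Proof.
move=> /and3P[_ _ hmu]; rewrite schur_alternant //.
by congr (\det _); apply/matrixP => l i; rewrite !mxE mnmE.
Qed.

(** After multiplication by Delta the expansion becomes one into alternants, from
    which [mcoeff_alternant_strict] extracts the coefficient. *)
Lemma schur_coef_unique p lam a : is_part n lam -> is_schur_coef p lam a ->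
  a = (p * vandermonde n R)@_(part_exp n lam).
Proof.
move=> hlam [P [c [uP /allP aP -> ->]]].
rewrite mulr_suml raddf_sum /=.
have coefE mu : mu \in P ->
    (c mu *: schur n R mu * vandermonde n R)@_(part_exp n lam) =
    (mu == lam)%:R * c mu.
  move=> /aP hmu; rewrite -scalerAl schur_part_exp // mcoeffZ.
  rewrite mcoeff_alternant_strict ?strict_part_exp // mulrC.
  by congr ((_ : bool)%:R * _); apply/eqP/eqP => [/part_exp_inj->|->].
have [lP|lP] := boolP (lam \in P).
  rewrite (bigD1_seq lam) //= coefE // eqxx mul1r big1_seq ?addr0 //.
  by move=> mu /andP[/negbTE ml /coefE->]; rewrite ml mul0r.
rewrite big1_seq // => mu /andP[_ muP]; rewrite coefE //.
case: eqP => [ml|_]; last by rewrite mul0r.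
by rewrite -ml muP in lP.
Qed.

Lemma schur_coef_exists p lam : alternating (p * vandermonde n R) ->
  exists a, is_schur_coef p lam a.
Proof.
move=> alt; set g := p * _ in alt.
pose c mu := g@_(part_exp n mu).
pose P := [seq exp_part e | e <- msupp g & strict_exp e].
exists (if lam \in P then c lam else 0), P, c; split => //.
- rewrite map_inj_in_uniq ?filter_uniq ?msupp_uniq //.
  move=> e f; rewrite !mem_filter => /andP[/exp_partP[_ he] _] /andP[/exp_partP[_ hf] _] ef.
  by rewrite -he ef hf.
- by apply/allP => mu /mapP[e]; rewrite mem_filter => /andP[/exp_partP[he _] _] ->.
apply: (mulIf vandermonde_neq0); rewrite -/g [LHS]alternating_expand //.
rewrite mulr_suml [RHS]big_map -[LHS]big_filter.
apply: eq_big_seq => e; rewrite mem_filter => /andP[he _].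
have [pe ee] := exp_partP he.
by rewrite -scalerAl (schur_part_exp pe) /c ee.
Qed.

End AlternatingBasis.

(** * The scalar product *)

Section ConstantTerms.
Variables (n : nat) (R : numFieldType).
Implicit Types (p q : {mpoly R[n]}).

(* The substitution x_i -> 1/x_i, with its constants embedded through the
   composite of two ring morphisms, inherits the morphism structure of mmap. *)
HB.instance Definition _ := GRing.RMorphism.copy (@at_Xdual n R)
  (mmap (@tofrac {mpoly R[n]} \o @mpolyC n R) (fun i => (xvar R i)^-1)).

Lemma xvar_neq0 i : @xvar n R i != 0.
Proof.
rewrite tofrac_eq0; apply/eqP => /mpolyP/(_ U_(i)%MM)/eqP.
by rewrite mcoeffX mcoeff0 eqxx oner_eq0.
Qed.

Lemma at_XdualU i : at_Xdual 'X_i = (@xvar n R i)^-1.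
Proof.
rewrite -[LHS]/(mmap (@tofrac {mpoly R[n]} \o @mpolyC n R) _ _).
by rewrite mmapX mmap1U.
Qed.

(** The constant term of x^e x^-f is 1 if e = f and 0 otherwise.  The proof
    clears denominators with a power of x_1 ... x_n exceeding every exponent of
    q. *)
Lemma const_term_pairing p q :
  const_term (at_X p * at_Xdual q) = \sum_(e <- msupp q) p@_e * q@_e.
Proof.
pose N := msize q; pose top : 'X_{1..n} := [multinom N | _ < n].
have le_top e : e \in msupp q -> (e <= top)%MM.
  move=> /msize_mdeg_lt/ltnW le_eN; apply/mnm_lepP => i; rewrite mnmE.
  by apply: leq_trans le_eN; rewrite mdegE (bigD1 i) //= leq_addr.
have -> : at_Xdual q =
    tofrac (\sum_(e <- msupp q) q@_e *: 'X_[top - e]) / mon_all n R ^+ N.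
  rewrite [LHS]/(mmap _ _ _) rmorph_sum /= mulr_suml !big_seq.
  apply: eq_bigr => e /le_top le_e.
  rewrite -mul_mpolyC tofracM -mulrA; congr (_ * _).
  apply: (mulIf (@mon_all_neq0 n R N)); rewrite divfK ?mon_all_neq0 //.
  rewrite mon_allE -/top -{1}(submK le_e) mpolyXD tofracM mulrCA.
  rewrite [X in _ * X](_ : _ = 1) ?mulr1 //.
  rewrite /mmap1 mpolyXE_id rmorph_prod -big_split /= big1 // => i _.
  by rewrite rmorphXn /= -exprMn mulVf ?expr1n ?xvar_neq0.
rewrite mulrA -tofracM const_termE -/top mulr_sumr raddf_sum /= !big_seq.
apply: eq_bigr => e /le_top le_e.
by rewrite -scalerAr mcoeffZ mulrC -{1}(submK le_e) mcoeffMX.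
Qed.

Lemma prod_neq_split (T : comNzRingType) (F : 'I_n -> 'I_n -> T) :
  \prod_(i < n) \prod_(j < n | i != j) F i j =
  \prod_(i < n) \prod_(j < n | (i < j)%N) (F i j * F j i).
Proof.
under [RHS]eq_bigr do rewrite big_split.
rewrite big_split /= [X in _ = _ * X](exchange_big_dep xpredT) //= -big_split.
apply: eq_bigr => i _.
rewrite (bigID (fun j : 'I_n => (i < j)%N)) /=; congr (_ * _); apply: eq_bigl => j.
all: by case: ltngtP => // [ij|ij|/val_inj ->]; rewrite ?eqxx // ?andbT ?andbF //;
  apply/eqP => e; rewrite e ltnn in ij.
Qed.

Lemma at_Xdual_vandermonde :
  at_Xdual (vandermonde n R) =
  \prod_(i < n) \prod_(j < n | (i < j)%N) ((xvar R i)^-1 - (xvar R j)^-1).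
Proof.
rewrite rmorph_prod; apply: eq_bigr => i _; rewrite rmorph_prod.
by apply: eq_bigr => j _; rewrite rmorphB /= !at_XdualU.
Qed.

Lemma at_X_vandermonde :
  at_X (vandermonde n R) =
  \prod_(i < n) \prod_(j < n | (i < j)%N) (xvar R i - xvar R j).
Proof.
rewrite /at_X rmorph_prod; apply: eq_bigr => i _; rewrite rmorph_prod.
by apply: eq_bigr => j _; rewrite rmorphB.
Qed.

Lemma weight_pair (F : fieldType) (x y : F) : x != 0 -> y != 0 ->
  (1 - x * y^-1) * (1 - y * x^-1) = (x - y) * (x^-1 - y^-1).
Proof. by move=> x0 y0; field; rewrite x0 y0. Qed.

Lemma weight_vandermonde :
  \prod_(i < n) \prod_(j < n | i != j) (1 - xvar R i * (xvar R j)^-1) =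
  at_X (vandermonde n R) * at_Xdual (vandermonde n R).
Proof.
rewrite prod_neq_split at_X_vandermonde at_Xdual_vandermonde -big_split /=.
apply: eq_bigr => i _; rewrite -big_split /=; apply: eq_bigr => j _.
exact: weight_pair (xvar_neq0 i) (xvar_neq0 j).
Qed.

Lemma scalar_prodE p q : scalar_prod p q =
  (n`!%:R)^-1 * const_term (at_X (p * vandermonde n R) *
                            at_Xdual (q * vandermonde n R)).
Proof.
rewrite /scalar_prod weight_vandermonde rmorphM /at_X tofracM.
by rewrite mulrACA.
Qed.

(** The term of a_(lam + delta) attached to s meets the coefficient of f Delta
    at the permuted exponent; the two signs of s cancel, so that all n! terms
    are equal. *)
Lemma scalar_prod_schur q lam : is_part n lam ->
  alternating (q * vandermonde n R) ->
  scalar_prod (schur n R lam) q = (q * vandermonde n R)@_(part_exp n lam).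
Proof.
move=> hlam alt; rewrite scalar_prodE schur_part_exp // const_term_pairing.
set g := q * _ in alt *; set a := part_exp n lam.
under eq_bigr do rewrite mcoeff_alternant mulr_suml.
rewrite exchange_big /= (eq_bigr (fun=> g@_a)) => [|s _].
  rewrite sumr_const card_Sn -[X in _ * X]mulr_natl mulKf //.
  by rewrite pnatr_eq0 -lt0n fact_gt0.
set e := [multinom _ | _ < n]; have ge : g@_e = (-1) ^+ s * g@_a by rewrite -alt.
transitivity ((-1) ^+ s * g@_e); last by rewrite ge mulrA -expr2 sqrr_sign mul1r.
have [ep|ep] := boolP (e \in msupp g).
  rewrite (bigD1_seq e) ?msupp_uniq //= eqxx mulr1 big1 ?addr0 // => f /negbTE.
  by rewrite eq_sym => ->; rewrite mulr0 mul0r.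
rewrite (memN_msupp_eq0 ep) mulr0 big1_seq // => f /andP[_ fp].
case: eqP => [ef|_]; last by rewrite mulr0 mul0r.
by rewrite ef fp in ep.
Qed.

End ConstantTerms.

(** * The hyperdeterminant *)

Section Hyperdeterminant.
Variables (n : nat) (R : numFieldType).

(** The sum defining a hyperdeterminant appears by distributing a product of K
    determinants: each factor contributes one permutation with its sign. *)
Lemma mcoeff_prod_alternant K (b : 'I_K -> 'I_n -> nat) m :
  (\prod_j alternant R (b j))@_m =
  \sum_(s : {ffun 'I_K -> 'S_n})
    (\prod_j (-1) ^+ (s j : bool)) *
    \prod_(i < n) (\sum_j b j (s j i) == m i)%N%:R.
Proof.
under eq_bigr do rewrite alternantE.
rewrite bigA_distr_bigA raddf_sum; apply: eq_bigr => s _ /=.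
rewrite scaler_prod -(big_morph _ (@mpolyXD n R) (mpolyX0 n R)) mcoeffZ mcoeffX.
congr (_ * _); case: eqP => [<-|ne].
  rewrite big1 // => i _; rewrite mnm_sumE.
  by under [X in _ == X]eq_bigr do rewrite mnmE; rewrite eqxx.
have /existsP[i hi] : [exists i : 'I_n, \sum_j b j (s j i) != m i]%N.
  rewrite -negb_forall; apply/negP => /forallP h; apply: ne; apply/mnmP => i.
  by rewrite mnm_sumE -(eqP (h i)); apply: eq_bigr => j _; rewrite mnmE.
by rewrite (bigD1 i) //= (negbTE hi) mul0r.
Qed.

(** Each pair i < j contributes 1/x_i - 1/x_j = - (x_i - x_j) / (x_i x_j); there
    are n(n-1)/2 pairs, and each variable occurs in n - 1 of them. *)
Lemma at_Xdual_vandermondeE :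
  at_Xdual (vandermonde n R) =
  (-1) ^+ ((n * (n - 1)) %/ 2) *
    (tofrac (vandermonde n R) / mon_all n R ^+ (n - 1)).
Proof.
have dual_pair (F : fieldType) (x y : F) : x != 0 -> y != 0 ->
    x^-1 - y^-1 = -1 * ((x - y) * (x^-1 * y^-1)).
  by move=> x0 y0; field; rewrite x0 y0.
rewrite at_Xdual_vandermonde -[tofrac _]/(at_X _) at_X_vandermonde.
transitivity (\prod_(i < n) \prod_(j < n | (i < j)%N)
    (-1 * ((xvar R i - xvar R j) * ((xvar R i)^-1 * (xvar R j)^-1)))).
  apply: eq_bigr => i _; apply: eq_bigr => j _.
  exact: dual_pair (xvar_neq0 R i) (xvar_neq0 R j).
under eq_bigr do rewrite big_split big_split /=.
rewrite !big_split /=; congr (_ * (_ * _)).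
  rewrite (exchange_big_dep xpredT) //=.
  under eq_bigr => j _ do
    rewrite (big_ord_narrow (ltnW (ltn_ord j))) prodr_const card_ord.
  by rewrite prodrXr -(big_mkord xpredT id) bin2_sum bin2 divn2 subn1.
rewrite -(prod_neq_split (fun i _ => (xvar R i)^-1)) /mon_all -prodrXl -prodfV.
apply: eq_bigr => i _; rewrite prodr_const -exprVn; congr (_ ^+ _).
rewrite -[in RHS](card_ord n) subn1 -(cardC1 i).
by apply: eq_card => j; rewrite !inE eq_sym.
Qed.

(** The shift by lam sits on the factor j0 alone, as in the Hankel entries only
    the first index is shifted. *)
Lemma hankel_hyperdet_A0 K (lam : seq nat) (N : nat) (j0 : 'I_(2 * K)) :
  j0 = 0%N :> nat ->
  hankel_hyperdet K (fun i : 'I_n => reverse_part lam i - N%:Z) (A0 R) =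
  (n`!%:R)^-1 *
  (\prod_(j < 2 * K) alternant R (fun i : 'I_n =>
     i + (if j == j0 then nth 0 lam (rev_ord i) else 0))%N)@_[multinom N | _ < n].
Proof.
move=> j00; rewrite mcoeff_prod_alternant /hankel_hyperdet /hyperdet.
congr (_ * _); apply: eq_bigr => s _; congr (_ * _); apply: eq_bigr => i _.
rewrite /= mnmE [X in _ + X](big_pred1 j0) => [|j]; last first.
  by rewrite -[RHS](inj_eq val_inj) /= j00.
rewrite addrA subr_eq0 big_split /= -big_mkcond /= big_pred1_eq /reverse_part.
rewrite -(@big_morph _ _ Posz 0 +%R 0%N addn PoszD erefl) -PoszD eqz_nat.
by [].
Qed.

(** Reversing the exponents multiplies each of the 2k+2 alternants by the sign of
    the reversal, and an even number of these signs cancels. *)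
Lemma prod_alternant_reverse (lam : seq nat) (k : nat) (j0 : 'I_(2 * k.+1)) :
  (size lam <= n)%N ->
  \prod_(j < 2 * k.+1) alternant R (fun i : 'I_n =>
     i + (if j == j0 then nth 0 lam (rev_ord i) else 0))%N =
  alternant R (@shifted n lam) * vandermonde n R ^+ (2 * k + 1).
Proof.
move=> hlam; pose sg : {mpoly R[n]} := (-1) ^+ rev_perm n.
have shiftE : alternant R (fun i : 'I_n => i + nth 0 lam (rev_ord i))%N =
    sg * alternant R (@shifted n lam).
  rewrite -alternant_perm; congr (\det _); apply/matrixP => l i; rewrite !mxE /=.
  rewrite permE /shifted /= addnC; congr (_ ^+ (_ + _)).
  by rewrite subnSK // subKn // ltnW.
have vanE : alternant R (fun i : 'I_n => i + 0)%N = sg * vandermonde n R.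
  rewrite vandermonde_alternant -alternant_perm.
  congr (\det _); apply/matrixP => l i; rewrite !mxE /= addn0.
  by rewrite permE /= subnSK // subKn // ltnW.
rewrite (bigD1 j0) //= eqxx shiftE.
rewrite (eq_bigr (fun=> sg * vandermonde n R)) => [|j /negbTE ->]; last exact: vanE.
rewrite prodr_const (_ : #|_| = (2 * k + 1)%N); last first.
  by rewrite cardC1 card_ord; lia.
rewrite exprMn mulrACA -exprS (_ : (2 * k + 1).+1 = 2 * k.+1)%N; last by lia.
by rewrite exprM sqrr_sign expr1n mul1r.
Qed.

End Hyperdeterminant.

Theorem corollary5p1 (R : numFieldType) (n k : nat) (lam : seq nat)
    (hn : (1 <= n)%N) (hk : (1 <= k)%N) (hlam : is_part n lam) :
  (forall a : R,
     is_schur_coef (vandermonde n R ^+ (2 * k)) lam a <->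
     a = scalar_prod (schur n R lam) (vandermonde n R ^+ (2 * k))) /\
  scalar_prod (schur n R lam) (vandermonde n R ^+ (2 * k)) =
  (-1) ^+ ((n * (n - 1)) %/ 2) *
  hankel_hyperdet k.+1
    (fun i : 'I_n => reverse_part lam i - ((2 * k + 1) * (n - 1))%N%:Z)
    (A0 R).
Proof.
set f := vandermonde n R ^+ (2 * k).
have alt : alternating (f * vandermonde n R).
  apply: alternating_sign => s; rewrite rmorphM rmorphXn /=.
  rewrite vandermonde_alternant msym_alternant -vandermonde_alternant.
  by rewrite exprMn exprM sqrr_sign expr1n mul1r mulrCA.
split=> [a|].
  rewrite scalar_prod_schur //; split=> [/schur_coef_unique->//|->].
  have [b hb] := schur_coef_exists lam alt.
  by rewrite -(schur_coef_unique hlam hb).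
have sz : (size lam <= n)%N by case/and3P: hlam.
have lt0 : (0 < 2 * k.+1)%N by rewrite muln_gt0.
rewrite (@hankel_hyperdet_A0 _ _ _ _ _ (Ordinal lt0)) // prod_alternant_reverse //.
rewrite scalar_prodE schur_alternant // [RHS]mulrCA; congr (_ * _).
rewrite -exprSr -addn1; set N := ((2 * k + 1) * (n - 1))%N.
set V := vandermonde n R; set A := alternant R _; set c := (_ %/ 2)%N.
have -> : at_X A * at_Xdual (V ^+ (2 * k + 1)) =
    tofrac ((-1) ^+ c * (A * V ^+ (2 * k + 1))) / mon_all n R ^+ N.
  rewrite rmorphXn /= at_Xdual_vandermondeE -/c -/V exprMn expr_div_n.
  rewrite -!exprM [(c * _)%N]mulnC exprM [(-1) ^+ (2 * k + 1)]exprD exprM sqrrN.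
  rewrite !expr1n mul1r expr1 [((n - 1) * _)%N]mulnC -/N /at_X.
  by rewrite !tofracM !tofracXn tofracN tofrac1 mulrCA !mulrA.
by rewrite const_termE -[in LHS]signr_odd -[in RHS]signr_odd; case: (odd c);
  rewrite ?mulN1r ?mcoeffN ?mul1r ?mulN1r.
Qed.
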